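(* Let $A$ be a finite-dimensional noncommutative derivation algebra over a field $\mathbb{F}$ of characteristic zero. Then $T(A)\neq\{0\}$.
   Context: A left-symmetric algebra over $\mathbb{F}$ is a vector space $A$ over $\mathbb{F}$ with a bilinear product $\cdot$ such that $(x\cdot y)\cdot z-x\cdot(y\cdot z)=(y\cdot x)\cdot z-y\cdot(x\cdot z)$ for all $x,y,z\in A$. A derivation algebra is a left-symmetric algebra satisfying $(x\cdot y)\cdot z=(z\cdot y)\cdot x$ for all $x,y,z\in A$. Put $T(A)=\{x\in A: x\cdot y=0\text{ for all }y\in A\}$. *)

(* Defs.v *)
From mathcomp Require Import all_boot all_algebra.
From mathcomp Require Import classical_sets.

Set Implicit Arguments.
Unset Strict Implicit.
Unset Printing Implicit Defensive.

Import GRing.Theory.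
Local Open Scope ring_scope.
Local Open Scope classical_set_scope.

Section Algebras.
Variables (F : fieldType) (A : vectType F).
Implicit Type mul : {bilinear A -> A -> A}.

Definition left_symmetric mul : Prop := forall x y z : A,
  mul (mul x y) z - mul x (mul y z) = mul (mul y x) z - mul y (mul x z).

(* Not the Lie algebra of derivations of an algebra. *)
Definition derivation_algebra mul : Prop :=
  left_symmetric mul /\
  (forall x y z : A, mul (mul x y) z = mul (mul z y) x).

Definition T_set mul : set A := [set x | forall y : A, mul x y = 0].

End Algebras.

(* Main.v *)
(* Write [P b d] for the value of the word [((a b) c) d] and [Z b d e] for that
   of [(((a b) c) d) e] under a fixed linear form; by left invertivity
   [(x y) z = (z y) x] these depend only on the letters displayed, [a] and [c]
   being interchangeable. Left symmetry yields
     [P i j + P k i = P i k + P k l].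
   Substituting a product [x y] for [j] expresses [((k i) l) (x y)] through [Z];
   this element is invariant under exchanging [(k, i)] and [(x, y)], which gives
   an exchange relation for [Z]. These relations force
     [3 (Z b d e - Z d b e) = 0].
   If [T(A) = 0], a right factor common to all words of an identity can be
   cancelled, so [P] is symmetric, and then [P i j = P k l]. Now two exchange
   relations show that the last two letters of [(((a b) c) d) e] commute.
   Together these symmetries allow the exchange of [a] and [b], and cancelling
   [e], [d] and [c] leaves [a b = b a]. *)
Require Import Defs.
From mathcomp Require Import all_boot all_algebra.
From mathcomp Require Import classical_sets.
From mathcomp Require Import ring.

Import GRing.Theory.
Local Open Scope ring_scope.
Local Open Scope classical_set_scope.

(** Turns vector identities into identities in [F], within reach of [ring]. *)
Lemma scalar_separation (F : fieldType) (V : vectType F) (u v : V) :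
  (forall f : {scalar V}, f u = f v) -> u = v.
Proof.
move=> fE; rewrite (coord_vbasis (memvf u)) (coord_vbasis (memvf v)).
by apply: eq_bigr => i _; rewrite (fE (coord (vbasis fullv) i)).
Qed.

Lemma linear_combination {V : zmodType} {l r u v : V} :
  l = r -> u - v = l - r -> u = v.
Proof. by move=> -> /eqP; rewrite subrr subr_eq0 => /eqP. Qed.

Lemma eqD {V : zmodType} {l r l' r' : V} : l = r -> l' = r' -> l + l' = r + r'.
Proof. by move=> -> ->. Qed.

Section DerivationAlgebra.
Variables (F : fieldType) (A : vectType F) (mul : {bilinear A -> A -> A}).
Hypothesis charF0 : [pchar F] =i pred0.
Hypothesis derA : derivation_algebra mul.

Local Infix "*'" := mul (at level 40, left associativity).
Implicit Types (f : {scalar A}) (a b c d e i j k l x y z : A).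

Lemma left_invertive x y z : x *' y *' z = z *' y *' x.
Proof. by case: derA => _; apply. Qed.

Lemma natr_neq0 n : n.+1%:R != 0 :> F.
Proof. by rewrite (pcharf0P F).1. Qed.

Lemma left_symmetric_scalar f x y z :
  f (x *' y *' z) - f (x *' (y *' z)) = f (y *' x *' z) - f (y *' (x *' z)).
Proof. by case: derA => lsA _; rewrite -!linearB lsA. Qed.

Lemma left_symmetric_scalar_mulr f x y z t :
  f (x *' y *' z *' t) - f (x *' (y *' z) *' t) =
  f (y *' x *' z *' t) - f (y *' (x *' z) *' t).
Proof. by case: derA => lsA _; rewrite -!linearB -!linearBl lsA. Qed.

(** By left invertivity, [c ((a b) d)], [d (a b) c] and [a (d b) c] each occur in two of the
    relations and cancel. *)
Lemma six_term f a b c d :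
  f (a *' b *' c *' d) + f (c *' a *' b *' d) + f (a *' d *' b *' c) =
  f (c *' d *' b *' a) + f (d *' b *' c *' a) + f (d *' a *' b *' c).
Proof.
have E1 := left_symmetric_scalar f (a *' b) c d.
have E2 := left_symmetric_scalar f (d *' b) c a.
have E3 := left_symmetric_scalar_mulr f d a b c.
rewrite (left_invertive c (a *' b) d) in E1.
rewrite (left_invertive c (d *' b) a) (left_invertive d b a) in E2.
rewrite (left_invertive (c *' d) b a) (left_invertive (c *' a) b d).
apply: (linear_combination (eqD (eqD E1 (esym E2)) (esym E3))); ring.
Qed.

Lemma four_term i j k l :
  k *' i *' l *' j + j *' k *' l *' i = j *' i *' l *' k + i *' k *' j *' l.
Proof.
apply: scalar_separation => f; rewrite !linearD /=.
have E1 := six_term f k l j i.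
have E2 := six_term f k j i l.
have E3 := six_term f k i l j.
rewrite ?(left_invertive j k i) ?(left_invertive k j i) ?(left_invertive k l j)
  ?(left_invertive l j i) ?(left_invertive l k i) ?(left_invertive l k j)
  in E1 E2 E3 *.
(* [E1 - E2 + E3] is twice the goal. *)
apply: (mulfI (natr_neq0 1)).
apply: (linear_combination (eqD (eqD E1 (esym E2)) E3)); ring.
Qed.

Lemma four_term_mulr i j k l e :
  k *' i *' l *' j *' e + j *' k *' l *' i *' e =
  j *' i *' l *' k *' e + i *' k *' j *' l *' e.
Proof. by rewrite -!linearDl four_term. Qed.

Lemma exchange i y l k x :
  x *' y *' i *' l *' k + x *' y *' k *' i *' l + k *' i *' x *' l *' y =
  k *' i *' y *' l *' x + k *' i *' x *' y *' l + x *' y *' k *' l *' i.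
Proof.
(* Both instances contain [((x y) l) (k i)], which is eliminated. *)
have E1 := four_term i (x *' y) k l.
have E2 := four_term y (k *' i) x l.
rewrite (left_invertive i k) (left_invertive (k *' i) l) in E1.
rewrite (left_invertive y x) in E2.
by rewrite -E1 addrAC E2.
Qed.

(* [E1] to [E8] and their coefficients come from solving the linear system of
   all multilinear instances of [four_term_mulr] and [exchange]. *)
Lemma swap24_mulr a b c d e :
  d *' a *' e *' b *' c = d *' b *' e *' a *' c.
Proof.
apply: scalar_separation => f; apply: (mulfI (natr_neq0 2)).
have E1 := congr1 f (four_term_mulr b e a d c).
have E2 := congr1 f (exchange e a c d b).
have E3 := congr1 f (exchange e b c a d).
have E4 := congr1 f (exchange e a c b d).
have E5 := congr1 f (exchange b a c d e).
have E6 := congr1 f (exchange e b c d a).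
have E7 := congr1 f (four_term_mulr a d e b c).
have E8 := congr1 f (exchange a b c d e).
rewrite ?(left_invertive b e a) ?(left_invertive d a b) ?(left_invertive d b a)
  ?(left_invertive d e a) ?(left_invertive d e b) ?(left_invertive e a b)
  ?(left_invertive e a d) ?(left_invertive e b a) ?(left_invertive e b d)
  !linearD /= in E1 E2 E3 E4 E5 E6 E7 E8 *.
have E34 := eqD (esym E3) E4.
apply: (linear_combination (eqD (eqD (eqD (eqD E1 (esym E2)) (eqD E34 E34))
  (eqD E5 E6)) (eqD E7 (esym E8)))); ring.
Qed.

Section TrivialAnnihilator.
Hypothesis T0 : T_set mul = [set 0].

Lemma mulr_cancel u v : (forall w, u *' w = v *' w) -> u = v.
Proof.
move=> uv; apply/subr0_eq; suff : T_set mul (u - v) by rewrite T0.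
by move=> w; rewrite linearBl uv subrr.
Qed.

Lemma swap24 a b c d : a *' b *' c *' d = a *' d *' c *' b.
Proof. by apply: mulr_cancel => e; apply: swap24_mulr. Qed.

Lemma swap12_34 a b c d : a *' b *' c *' d = b *' a *' d *' c.
Proof.
by have := four_term b d a c; rewrite (swap24 d a) addrC => /addrI.
Qed.

Lemma reverse4 a b c d : a *' b *' c *' d = d *' c *' b *' a.
Proof. by rewrite swap12_34 (left_invertive b) swap24. Qed.

Lemma exchange_reduced i y l k x :
  x *' y *' i *' l *' k + k *' i *' x *' l *' y =
  k *' i *' y *' l *' x + x *' y *' k *' l *' i.
Proof.
have := exchange i y l k x.
(* The middle terms agree: [x y k i = k y x i = k i x y]. *)
rewrite (left_invertive x y k) (swap24 k y) addrAC [RHS]addrAC.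
exact: addIr.
Qed.

Lemma swap45 a b c d e : a *' b *' c *' d *' e = a *' b *' c *' e *' d.
Proof.
have K1 := exchange_reduced b c e a d.
have K2 := exchange_reduced a b d e c.
(* Makes the right side of [K2] the left side of [K1], up to order. *)
rewrite (left_invertive c b a) (reverse4 e a c) (reverse4 e a b)
  (left_invertive d b a) (reverse4 c b e) (swap24 d e) addrC in K2.
by apply: (@addrI _ (d *' c *' a *' e *' b)); rewrite K2 addrC K1 addrC.
Qed.

Lemma mulC : commutative mul.
Proof.
move=> a b; apply: mulr_cancel => c; apply: mulr_cancel => d.
apply: mulr_cancel => e.
(* Each of three rounds swaps [a], [b] and rotates [c d e]; the rotation has order three, so only
   the swap remains. *)
by rewrite (swap12_34 a) swap45 (swap12_34 b) swap45 (swap12_34 a) swap45.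
Qed.

End TrivialAnnihilator.
End DerivationAlgebra.

Theorem corollary24 (F : fieldType) (charF0 : [pchar F] =i pred0)
    (A : vectType F) (mul : {bilinear A -> A -> A})
    (derA : derivation_algebra mul) (ncA : ~ commutative mul) :
  T_set mul <> [set 0].
Proof. by move=> T0; apply: ncA; apply: mulC. Qed.
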